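(* Let $N\ge 1$ and $1\le n\le N$ be integers, let $v_1,\dots,v_N\in\mathbb{C}$, and let $\sigma_{N,n}$ denote the $n$-th elementary symmetric polynomial evaluated at $v_1,\dots,v_N$. Define recursively, for every $d\in\{1,\dots,N\}$, $$f_0(v_d)=v_d,\qquad C_0=\sum_{d=1}^{N} f_0(v_d),$$ and, for $i=1,2,\dots,n-1$, $$f_i(v_d)=v_d\left[C_{i-1}-(n-i)\,f_{i-1}(v_d)\right],\qquad C_i=\sum_{d=1}^{N} f_i(v_d).$$ Then $$\sigma_{N,n}=\frac{1}{n!}\,C_{n-1}.$$
   Context: The $n$-th elementary symmetric polynomial over the nodes $v_1,\dots,v_N$ is the sum of products over $n$ pairwise distinct indices, each set of indices being counted once (no permutations of the same product): $$\sigma_{N,n}=\sum_{\{r_1,\dots,r_n\}\subseteq\{1,\dots,N\}} v_{r_1}v_{r_2}\cdots v_{r_n},$$ where the sum runs over all $n$-element subsets $\{r_1,\dots,r_n\}$ of $\{1,\dots,N\}$. *)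

(* Defs.v *)
From HB Require Import structures.
From mathcomp Require Import all_boot all_order all_algebra.
From mathcomp Require Import reals complex.

Set Implicit Arguments.
Unset Strict Implicit.
Unset Printing Implicit Defensive.

Import Order.TTheory GRing.Theory Num.Theory.
Local Open Scope ring_scope.
Local Open Scope complex_scope.

(* The complex numbers are R[i] with R : realType; the nodes v_1, ..., v_N are
   indexed from 0, as a family over 'I_N. *)

Definition elem_sym (R : realType) (N n : nat) (v : 'I_N -> R[i]) : R[i] :=
  \sum_(A : {set 'I_N} | #|A| == n) \prod_(r in A) v r.

(* node_f n v i d is f_i(v_d), and node_C n v i is C_i. Both depend on n through
   the factor n - i, which is computed in R[i], not truncated. f_i is a function
   of the index d; since f_i(v_d) depends on d only through the value v_d, this
   agrees with applying f_i to that value. *)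
Fixpoint node_f (R : realType) (N n : nat) (v : 'I_N -> R[i]) (i : nat)
    (d : 'I_N) : R[i] :=
  if i is j.+1 then
    v d * (\sum_(e < N) node_f n v j e - (n%:R - i%:R) * node_f n v j d)
  else v d.

Definition node_C (R : realType) (N n : nat) (v : 'I_N -> R[i]) (i : nat) :
    R[i] :=
  \sum_(d < N) node_f n v i d.

(* Main.v *)
Require Import Defs.
From HB Require Import structures.
From mathcomp Require Import all_boot all_order all_algebra.
From mathcomp Require Import reals complex.
From mathcomp Require Import ring.

(** Write [e m D] for the [m]-th elementary symmetric polynomial in the nodes
    indexed by [D], and [T] for the set of all indices.  The quantity
      [(n - 1 - i)! * \sum_d f_i(v_d) * e (n - 1 - i) (T :\ d)]
    does not depend on [i].  At [i = 0] it is
    [(n - 1)! * \sum_d v_d * e (n - 1) (T :\ d)], which is [n! * e n T], because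
    each [n]-subset is obtained once for each of its [n] elements
    ([sum_esym_pointed]).  At [i = n - 1] it is [\sum_d f_(n-1)(v_d) = C_(n-1)].

    For the invariance put [m + 1 = n - 1 - i], so that
    [f_(i+1)(v_d) = v_d * (C_i - (m + 1) * f_i(v_d))].  In
    [\sum_d f_(i+1)(v_d) * e m (T :\ d)] the first term contributes
    [(m + 1) * C_i * e (m + 1) T], again by [sum_esym_pointed].  In the second,
    [v_d * e m (T :\ d) = e (m + 1) T - e (m + 1) (T :\ d)] ([esymS_setD1]), and
    the part with [e (m + 1) T] cancels the first term since
    [C_i = \sum_d f_i(v_d)].  What is left is
    [(m + 1) * \sum_d f_i(v_d) * e (m + 1) (T :\ d)]. *)

Set Implicit Arguments.
Unset Strict Implicit.
Unset Printing Implicit Defensive.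

Import Order.TTheory GRing.Theory Num.Theory.
Local Open Scope ring_scope.
Local Open Scope complex_scope.

Definition esym (K : comNzRingType) (I : finType) (v : I -> K) (m : nat)
    (D : {set I}) : K :=
  \sum_(A : {set I} | (A \subset D) && (#|A| == m)) \prod_(r in A) v r.

Lemma esym0 (K : comNzRingType) (I : finType) (v : I -> K) (D : {set I}) :
  esym v 0 D = 1.
Proof.
rewrite /esym (big_pred1 set0) ?big_set0 // => A.
by rewrite cards_eq0 andbC /=; case: eqP => // ->; rewrite sub0set.
Qed.

(** Removing [d] is a bijection from the [m.+1]-subsets of [D] through [d] to
    the [m]-subsets of [D :\ d], with inverse [setU [set d]]. *)
Lemma sum_subsets_through (K : comNzRingType) (I : finType) (v : I -> K)
    (m : nat) (D : {set I}) (d : I) : d \in D ->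
  \sum_(A : {set I} | [&& A \subset D, #|A| == m.+1 & d \in A])
     \prod_(r in A) v r
  = v d * esym v m (D :\ d).
Proof.
move=> dD; rewrite /esym big_distrr /=.
rewrite (reindex_onto (fun B => d |: B) (fun A => A :\ d)) /=; last first.
  by move=> A /and3P[_ _ dA]; rewrite setD1K.
apply: eq_big => [B|B /andP[_ /eqP dB]].
  rewrite subsetD1 subUset sub1set dD setU11 cardsU1 andbT /=.
  have -> : ((d |: B) :\ d == B) = (d \notin B).
    apply/eqP/idP => [<-|dB]; first by rewrite setD11.
    by rewrite setU1K.
  by case: (d \notin B); rewrite ?andbF ?andbT ?add1n ?eqSS.
by rewrite big_setU1 //= -dB setD11.
Qed.

Lemma esymS_setD1 (K : comNzRingType) (I : finType) (v : I -> K) (m : nat)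
    (D : {set I}) (d : I) : d \in D ->
  esym v m.+1 D = v d * esym v m (D :\ d) + esym v m.+1 (D :\ d).
Proof.
move=> dD; rewrite -sum_subsets_through // {1}/esym.
rewrite (bigID (fun A : {set I} => d \in A)) /=; congr (_ + _).
  by apply: eq_bigl => A; rewrite andbA.
by apply: eq_bigl => A; rewrite subsetD1 andbAC.
Qed.

(** Double counting of the pairs [(d, A)] with [d \in A] and [#|A| = m.+1]. *)
Lemma sum_esym_pointed (K : comNzRingType) (I : finType) (v : I -> K) (m : nat)
    (D : {set I}) :
  \sum_(d in D) v d * esym v m (D :\ d) = m.+1%:R * esym v m.+1 D.
Proof.
under eq_bigr => d dD do rewrite -sum_subsets_through //.
rewrite (exchange_big_dep (fun A : {set I} => (A \subset D) && (#|A| == m.+1)))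
  /=; last by move=> d A _ /and3P[-> ->].
rewrite /esym big_distrr /=; apply: eq_bigr => A /andP[AD /eqP cA].
rewrite AD cA eqxx /= mulr_natl -cA -sumr_const; apply: eq_bigl => d.
by apply: andb_idl; apply: subsetP.
Qed.

(** Here [m] is the number of indices still to be chosen after step [i].  Since
    [n] is fixed by the recursion, each induction step trades one unit of [m]
    for one of [i]; the factor [m`!] absorbs the coefficient [n - i] of [f]. *)
Lemma node_f_invariant (R : realType) (N n : nat) (v : 'I_N -> R[i])
    (i m : nat) : n = (i + m).+1 ->
  m`!%:R * \sum_(d < N) node_f n v i d * esym v m ([set: 'I_N] :\ d)
  = n`!%:R * esym v n [set: 'I_N].
Proof.
have pointed k : \sum_(d < N) v d * esym v k ([set: 'I_N] :\ d)
    = k.+1%:R * esym v k.+1 [set: 'I_N].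
  by rewrite -sum_esym_pointed; apply: eq_bigl => d; rewrite in_setT.
elim: i m => [|i IHi] m def_n.
  by rewrite /= pointed mulrA -natrM mulnC -factS def_n.
have step d : node_f n v i.+1 d
    = v d * (\sum_(e < N) node_f n v i e - m.+1%:R * node_f n v i d).
  by rewrite /= def_n addSn -addnS -addSn natrD [_ + m.+1%:R]addrC addrK.
rewrite -(IHi m.+1); last by rewrite def_n addSnnS.
rewrite factS natrM [m.+1%:R * _]mulrC -mulrA; congr (_ * _).
under eq_bigr => d _ do rewrite step.
transitivity ((\sum_(e < N) node_f n v i e) *
    (\sum_(d < N) v d * esym v m ([set: 'I_N] :\ d))
  - m.+1%:R * \sum_(d < N) node_f n v i d *
      (v d * esym v m ([set: 'I_N] :\ d))).
  rewrite !big_distrr /= -sumrB; apply: eq_bigr => d _.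
  (* Abstracting the atoms prevents [ring] from unfolding the recursion. *)
  move: (\sum_(e < N) _) (node_f _ _ _ _) (esym _ _ _) => C f e; ring.
rewrite pointed mulrCA -mulrBr; congr (_ * _).
rewrite big_distrl /= -sumrB; apply: eq_bigr => d _.
by rewrite (esymS_setD1 v m (in_setT d)); ring.
Qed.

Theorem theorem2p1 (R : realType) (N n : nat) (hN : (1 <= N)%N)
    (hn : (1 <= n <= N)%N) (v : 'I_N -> R[i]) :
  elem_sym n v = (n`!%:R)^-1 * node_C n v n.-1.
Proof.
have n_gt0 : (0 < n)%N by case/andP: hn.
have -> : elem_sym n v = esym v n [set: 'I_N].
  by apply: eq_bigl => A; rewrite subsetT.
have -> : node_C n v n.-1 = n`!%:R * esym v n [set: 'I_N].
  rewrite -(@node_f_invariant R N n v n.-1 0) ?addn0 ?prednK //.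
  by rewrite fact0 mul1r; apply: eq_bigr => d _; rewrite esym0 mulr1.
by rewrite mulKf // pnatr_eq0 -lt0n fact_gt0.
Qed.
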